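(* Let $\Delta$ be a $(d-1)$-dimensional pure shifted simplicial complex. Then there is a finite shifted order ideal $U$ such that $\Delta$ is (isomorphic to) the join of the squeezed complex $\Delta_0(U)$ and a $(d-1-d_{\max}(U))$-dimensional simplex (which is possibly the empty set).
   Context: Shifted complexes. A simplicial complex $\Delta$ on vertex set $[n]=\{1,\ldots,n\}$ is shifted if for every face $F\in\Delta$, every $i\in F$ and every $j\in[n]\setminus F$ with $j>i$, also $(F\setminus\{i\})\cup\{j\}\in\Delta$. A simplicial complex is pure if all its facets have the same dimension. The $(-1)$-dimensional simplex is $\{\emptyset\}$. Order ideals. Let $\mathbb{K}$ be a field and $P(m)=\mathbb{K}[x_1,\ldots,x_m]$. A monomial order ideal of $P(m)$ is a finite set $U$ of monomials of $P(m)$ closed under taking divisors; it is always assumed that $1,x_1,\ldots,x_m\in U$. $U$ is shifted if $x_iu\in U$ ($u$ a monomial) and $i<j\le m$ imply $x_ju\in U$. $d_{\max}(U)$ is the maximal degree of a monomial in $U$. In the claim $U$ is a shifted order ideal of $P(m)$ for some $m\ge 0$ (with $P(0)=\mathbb{K}$, $U=\{1\}$ in the degenerate case $m=0$). The squeezed complex $\Delta_0(U)$. Put $\delta=d_{\max}(U)$. For $u=x_{i_1}\cdots x_{i_s}\in U$ with $i_1\le\cdots\le i_s$ set $$F_0(u)=\{i_\ell+\ell-1 : 1\le \ell\le s\}\cup\{c\in\mathbb{N} : m+s+1\le c\le m+\delta\}.$$ $\Delta_0(U)$ is the pure $(\delta-1)$-dimensional simplicial complex on vertex set $[m+\delta]$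 whose facets are the sets $F_0(u)$, $u\in U$. *)

(* Defs.v *)
From HB Require Import structures.
From mathcomp Require Import all_boot all_order all_algebra.
From mathcomp Require Import finmap.
From mathcomp Require Import mpoly.

Set Implicit Arguments.
Unset Strict Implicit.
Unset Printing Implicit Defensive.

Import GRing.Theory Num.Theory.

Local Open Scope ring_scope.

Section Complexes.

Variable T : finType.
Implicit Types D : {set {set T}}.

(* Elements of T need not be vertices of D; see [vertex] below. *)
Definition simplicial_complex D : Prop :=
  set0 \in D /\ forall F G : {set T}, F \in D -> G \subset F -> G \in D.

Definition facet D (F : {set T}) : bool := maxset (mem D) F.

Definition face_dim (F : {set T}) : int := #|F|%:Z - 1.

(* Only meaningful when D is nonempty, e.g. for a simplicial complex. *)
Definition complex_dim D : int := (\max_(F in D) #|F|)%N%:Z - 1.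

Definition pure D : Prop :=
  forall F G : {set T}, facet D F -> facet D G -> face_dim F = face_dim G.

Definition vertex D : finType := {v : T | [set v] \in D}.

End Complexes.

(* The vertex i : 'I_n stands for i + 1 in [n] = {1, ..., n}. *)
Definition shifted_complex n (D : {set {set 'I_n}}) : Prop :=
  forall F, F \in D ->
  forall i j : 'I_n, i \in F -> j \notin F -> (i < j)%N ->
  j |: (F :\ i) \in D.

Definition complex_iso (S T : finType)
    (D : {set {set S}}) (E : {set {set T}}) : Prop :=
  exists f : vertex D -> vertex E, bijective f /\
    forall F : {set vertex D},
      ([set val v | v in F] \in D) = ([set val (f v) | v in F] \in E).

Definition join (S T : finType)
    (D : {set {set S}}) (E : {set {set T}}) : {set {set S + T}} :=
  [set (@inl S T) @: F :|: (@inr S T) @: G | F : {set S} in D, G : {set T} in E].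

(* The simplex with k vertices, of dimension k - 1; it is {set0} for k = 0. *)
Definition simplex k : {set {set 'I_k}} := [set: {set 'I_k}].

Section OrderIdeals.

Variable m : nat.
Implicit Types (u v : 'X_{1..m}) (U : {fset 'X_{1..m}}).

(* The monomial type 'X_{1..m} is written additively: 0 is the monomial 1,
   U_(i) is the variable of index i + 1, and v <= u means that v divides u. *)
Definition order_ideal U : Prop :=
  [/\ 0%MM \in U, forall i : 'I_m, U_(i)%MM \in U &
      forall u v, u \in U -> (v <= u)%MM -> v \in U].

Definition shifted_ideal U : Prop :=
  forall u (i j : 'I_m), (i < j)%N ->
  (U_(i) + u)%MM \in U -> (U_(j) + u)%MM \in U.

Definition dmax U : nat := (\max_(u <- U) mdeg u)%N.

(* For u = x_{i_1} ... x_{i_s} with i_1 <= ... <= i_s, [m2s u] is the sequence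
   i_1 - 1, ..., i_s - 1 in 'I_m.  As the vertex c : 'I_(m + delta) stands for
   c + 1, the conditions read c + 1 = i_l + l - 1 for some 1 <= l <= s (with
   l = k + 1 below), or m + s + 1 <= c + 1. *)
Definition F0 U u : {set 'I_(m + dmax U)} :=
  [set c : 'I_(m + dmax U) |
     [exists k : 'I_(mdeg u),
        nat_of_ord c == (nth 0 (map (@nat_of_ord m) (m2s u)) k + k)%N]
  || (m + mdeg u <= c)%N].

Definition Delta0 U : {set {set 'I_(m + dmax U)}} :=
  [set F : {set _} | [exists u : U, F \subset F0 U (fsval u)]].

End OrderIdeals.

(* Main.v *)
Require Import Defs.
From HB Require Import structures.
From mathcomp Require Import all_boot all_order all_algebra.
From mathcomp Require Import finmap.
From mathcomp Require Import mpoly.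
From mathcomp Require Import zify.

(** A face with d elements is the set of values of a strictly increasing
    sequence a_0 < ... < a_(d-1), and shiftedness of D says that the d-element
    faces are closed upward for the termwise order on such sequences
    ([shifted_values_raise]).

    Let o be the least vertex (o = n if there is none) and m = n - o - d.
    Subtracting from a its lowest possible values, l |-> a_l - (o + l), turns a
    d-element face into a weakly increasing sequence with values in {0, ..., m}.
    Reading the value i < m as the variable of index i and the value m as the
    constant 1, this is a monomial of degree at most d in m variables, and every
    such monomial arises from exactly one d-element subset of {o, ..., n - 1}.
    Let U be the set of monomials coming from faces of D.  Dividing a monomial,
    or replacing one of its variables by a later one, raises the sequence
    termwise, so U is a shifted order ideal.  It contains every variable because
    purity puts the vertex o in some d-element face, and the sequence of that
    face lies below that of x_i for every i.

    If delta = dmax U, the terms of index l >= delta of every sequence equal m.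
    Hence the last d - delta vertices lie in all facets and span a simplex that
    splits off as a join factor, while the first delta terms of the sequence of
    u spell out F_0(u).  This gives the isomorphism ([squeezing_iso]).

    Monomials are compared through partial degrees: the sequence of u has its
    term of index l at most j < m exactly when l is less than the degree of u in
    the variables of index at most j ([var_at_threshold]). *)

Set Implicit Arguments.
Unset Strict Implicit.
Unset Printing Implicit Defensive.

(** * Sets of naturals as increasing sequences *)

Section Sequences.
Local Open Scope nat_scope.

Definition increasing_below d (a : nat -> nat) : Prop :=
  forall i j, i < j -> j < d -> a i < a j.

Definition values n d (a : nat -> nat) : {set 'I_n} :=
  [set i : 'I_n | val i \in mkseq a d].

Lemma valuesP n d a (i : 'I_n) :
  reflect (exists2 l, l < d & val i = a l) (i \in values n d a).
Proof.
rewrite inE; apply: (iffP mapP) => -[l]; first by rewrite mem_iota; exists l.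
by move=> ld il; exists l; rewrite ?mem_iota.
Qed.

Lemma eq_values n d a b :
  (forall l, l < d -> a l = b l) -> values n d a = values n d b.
Proof.
by move=> eq_ab; apply/setP => i; apply/valuesP/valuesP => -[l ld ->];
  exists l; rewrite ?eq_ab.
Qed.

(** The terms are moved one at a time, starting from the last: when a_p is
    raised to b_p, the terms after it are already b_(p+1) < b_(p+2) < ..., so
    b_p is not taken and a single shift of D applies. *)
Lemma shifted_values_raise n (D : {set {set 'I_n}}) d a b :
  shifted_complex D -> increasing_below d a -> increasing_below d b ->
  (forall l, l < d -> a l <= b l) -> (forall l, l < d -> b l < n) ->
  values n d a \in D -> values n d b \in D.
Proof.
move=> shD inc_a inc_b le_ab b_n aD.
pose mix p l := if l < p then a l else b l.
suff: forall j p, p + j = d -> values n d (mix p) \in D.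
  by move/(_ d 0 erefl); congr (_ \in _); apply: eq_values.
elim=> [|j IH] p pd.
  rewrite addn0 in pd.
  by rewrite (eq_values n (b := a)) // => l ld; rewrite /mix pd ld.
have /IH pD : p.+1 + j = d by rewrite addSnnS.
have p_d : p < d by lia.
have := le_ab p p_d; rewrite leq_eqVlt => /orP[/eqP eq_p|lt_p].
  rewrite (eq_values n (b := mix p.+1)) // => l _; rewrite /mix ltnS.
  by case: ltngtP => // ->.
have apn : a p < n by apply: leq_trans lt_p (ltnW (b_n p p_d)).
have := shD _ pD (Ordinal apn) (Ordinal (b_n p p_d)).
have apm : Ordinal apn \in values n d (mix p.+1).
  by apply/valuesP; exists p; rewrite // /mix ltnSn.
have bpm : Ordinal (b_n p p_d) \notin values n d (mix p.+1).
  apply/negP => /valuesP[l ld] /=; rewrite /mix ltnS.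
  case: leqP => lp bal; last by have := inc_b _ _ lp ld; lia.
  have : a l <= a p.
    by move: lp; rewrite leq_eqVlt => /orP[/eqP-> //|/inc_a/(_ p_d)/ltnW].
  by lia.
move/(_ apm bpm lt_p); set X := (_ |: _).
suff -> : X = values n d (mix p) by [].
apply/setP => i; rewrite {}/X.
rewrite in_setU1 in_setD1; apply/orP/valuesP => [[/eqP ->|]|[l ld il]].
- by exists p; rewrite // /mix ltnn.
- case/andP => ne /valuesP[l ld il]; exists l => //; rewrite il /mix ltnS.
  have [//|//|lp] := ltngtP l p.
  by move: ne; rewrite -(inj_eq val_inj) /= il /mix lp ltnSn eqxx.
have [lp|lp|lp] := ltngtP l p.
- right; apply/andP; split.
    by rewrite -(inj_eq val_inj) /= il /mix lp neq_ltn inc_a.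
  by apply/valuesP; exists l; rewrite // il /mix lp ltnS ltnW.
- right; apply/andP; split.
    rewrite -(inj_eq val_inj) /= il /mix ltnNge (ltnW lp) /= neq_ltn orbC.
    by rewrite (ltn_trans lt_p) ?inc_b.
  by apply/valuesP; exists l; rewrite // il /mix ltnNge (ltnW lp) ltnNge lp.
by left; apply/eqP/val_inj; rewrite /= il /mix lp ltnn.
Qed.

Lemma values_of_set n (F : {set 'I_n}) :
  exists a, [/\ increasing_below #|F| a,
    forall l, l < #|F| -> a l < n & F = values n #|F| a].
Proof.
pose s := [seq val i | i <- enum F]; exists (nth 0 s).
have sz : size s = #|F| by rewrite size_map cardE.
split.
- have srt : sorted ltn s.
    apply: (subseq_sorted ltn_trans (s2 := iota 0 n)).
      by rewrite -val_enum_ord map_subseq // enumT /enum_mem filter_subseq.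
    exact: iota_ltn_sorted.
  move=> i j ij jd; apply: (sorted_ltn_nth ltn_trans) => //; rewrite inE sz //.
  exact: ltn_trans ij jd.
- by move=> l; rewrite -sz => /(mem_nth 0)/mapP[i _ ->]; apply: ltn_ord.
apply/setP => i; rewrite inE cardE -(size_map val) mkseq_nth.
by rewrite (mem_map val_inj) mem_enum.
Qed.

Lemma increasing_gap d a i j :
  increasing_below d a -> i <= j -> j < d -> a i + (j - i) <= a j.
Proof.
move=> inc_a; elim: j => [|j IH]; first by rewrite leqn0 => /eqP ->; lia.
rewrite leq_eqVlt => /orP[/eqP -> _|]; first by lia.
rewrite ltnS => ij jd; have := IH ij (ltnW jd).
by have := inc_a j j.+1 (ltnSn j) jd; lia.
Qed.

Lemma increasing_face_bounds n o (D : {set {set 'I_n}}) F :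
  (forall F G : {set 'I_n}, F \in D -> G \subset F -> G \in D) ->
  (forall v : 'I_n, [set v] \in D -> o <= v) -> F \in D ->
  exists a, [/\ increasing_below #|F| a, F = values n #|F| a &
    forall l, l < #|F| -> o + l <= a l <= n - #|F| + l].
Proof.
move=> D_down vertex_ge FD; have [a [inc_a a_n Fa]] := values_of_set F.
exists a; split=> // l lF; apply/andP; split.
  have F0 : 0 < #|F| by lia.
  have : o <= Ordinal (a_n 0 F0).
    apply: vertex_ge; apply: D_down FD _.
    by rewrite sub1set Fa; apply/valuesP; exists 0.
  by have := increasing_gap inc_a (leq0n l) lF; rewrite /=; lia.
have FF : #|F|.-1 < #|F| by lia.
have lFF : l <= #|F|.-1 by lia.
by have := increasing_gap inc_a lFF FF; have := a_n _ FF; lia.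
Qed.

(** The default value m of [nth] makes s behave as if it were continued by
    m, m, ..., which is harmless for thresholds j < m. *)
Lemma nth_leq_count m s l j :
  sorted leq s -> j < m -> (nth m s l <= j) = (l < count (leq^~ j) s).
Proof.
move=> + jm; elim: s l => [|x s IH] l srt.
  by rewrite nth_nil leqNgt jm.
have srt' := path_sorted srt.
rewrite /=; case: (leqP x j) => xj; first by case: l => //= l; rewrite IH.
have c0 : count (leq^~ j) s = 0.
  apply/eqP; rewrite -leqn0 leqNgt -has_count; apply/hasPn => y ys.
  have /allP/(_ y ys) := order_path_min leq_trans srt; lia.
rewrite c0; case: l => [|l] /=; first by lia.
by rewrite IH // c0.
Qed.

Lemma leq_of_thresholds m x y :
  x <= m -> (forall j, j < m -> y <= j -> x <= j) -> x <= y.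
Proof. by move=> xm xy; case: (ltnP y m) => ym; [apply: xy|lia]. Qed.

End Sequences.

(** * Monomials as weakly increasing sequences *)

Section Monomials.
Local Open Scope nat_scope.
Variable m : nat.
Implicit Types u v : 'X_{1..m}.

(** The default value m stands for the factor 1, as if u were homogenized by one
    more variable, of index m. *)
Definition var_at u l : nat := nth m [seq val i | i <- m2s u] l.

Lemma var_at_le u l : var_at u l <= m.
Proof.
rewrite /var_at; set s := map _ _; have [ls|ls] := ltnP l (size s).
  have /mapP[i _ ->] := mem_nth m ls; exact: ltnW (ltn_ord i).
by rewrite nth_default.
Qed.

Lemma var_at_default u l : mdeg u <= l -> var_at u l = m.
Proof. by move=> ul; rewrite /var_at nth_default // size_map size_m2s. Qed.

Lemma count_m2s u (p : pred nat) :
  count p [seq val i | i <- m2s u] = \sum_(i < m | p i) u i.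
Proof.
rewrite count_map /m2s count_flatten -map_comp sumnE big_map big_enum_cond.
rewrite [RHS]big_mkcond /=; apply: eq_bigr => i _.
by rewrite count_nseq /=; case: (p i); rewrite ?mul1n.
Qed.

Lemma var_at_threshold u l j :
  j < m -> (var_at u l <= j) = (l < \sum_(i < m | i <= j) u i).
Proof.
by move=> jm; rewrite /var_at nth_leq_count ?srt_m2s // count_m2s.
Qed.

Lemma var_at_homo u l l' : l <= l' -> var_at u l <= var_at u l'.
Proof.
move=> ll'; apply: leq_of_thresholds (var_at_le u l) _ => j jm.
by rewrite !var_at_threshold //; apply: leq_ltn_trans.
Qed.

Lemma var_at_anti u v :
  (forall j, j < m -> \sum_(i < m | i <= j) v i <= \sum_(i < m | i <= j) u i) ->
  forall l, var_at u l <= var_at v l.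
Proof.
move=> le_vu l; apply: leq_of_thresholds (var_at_le u l) _ => j jm.
by rewrite !var_at_threshold // => /leq_trans-> //; apply: le_vu.
Qed.

(** The exponents are the multiplicities in t; the entries of t equal to m are
    the factors 1 and are dropped. *)
Lemma monomial_of_sorted t :
  sorted leq t -> all (leq^~ m) t ->
  exists2 u, mdeg u <= size t & forall l, var_at u l = nth m t l.
Proof.
move=> srt tm; exists [multinom count_mem (val i) t | i < m].
  rewrite mdegE (eq_bigr (fun i : 'I_m => count_mem (val i) t)); last first.
    by move=> i _; rewrite mnmE.
  elim: t {srt tm} => [|x t IH]; first by rewrite big1.
  rewrite big_split /= -add1n leq_add //.
  case: (ltnP x m) => xm.
    rewrite (bigD1 (Ordinal xm)) //= eqxx big1 // => i ne.
    by apply/eqP; rewrite eqb0 eq_sym.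
  by rewrite big1 // => i _; apply/eqP; rewrite eqb0; have := ltn_ord i; lia.
set u := [multinom _ | _ < _] => l.
have key j : j < m -> (var_at u l <= j) = (nth m t l <= j).
  move=> jm; rewrite var_at_threshold // nth_leq_count //; congr (_ < _).
  under eq_bigr do rewrite mnmE.
  elim: t {srt tm u} => [|x t IH]; first by rewrite big1.
  rewrite big_split /= IH; congr (_ + _).
  case: (leqP x j) => xj.
    have xm := leq_ltn_trans xj jm.
    rewrite (bigD1 (Ordinal xm)) //= eqxx big1 // => i /andP[_ ne].
    by apply/eqP; rewrite eqb0 eq_sym.
  by rewrite big1 // => i ij; apply/eqP; rewrite eqb0; lia.
have tlm : nth m t l <= m.
  have [ls|ls] := ltnP l (size t); last by rewrite nth_default.
  exact: (allP tm _ (mem_nth m ls)).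
apply/eqP; rewrite eqn_leq; apply/andP; split.
  by apply: leq_of_thresholds (var_at_le _ _) _ => j jm; rewrite key.
by apply: leq_of_thresholds tlm _ => j jm; rewrite key.
Qed.

End Monomials.

(** * The ideal of a pure shifted complex and the isomorphism *)

(** D may live on a larger ground set than its vertex set, so the map is taken
    from the ground set of E, all of which can be placed in that of D. *)
Lemma complex_iso_of_injection (S T : finType) (h : T -> S)
    (D : {set {set S}}) (E : {set {set T}}) :
  injective h ->
  (forall A : {set T}, (A \in E) = (h @: A \in D)) ->
  (forall v, [set v] \in D -> exists w, h w = v) ->
  complex_iso D E.
Proof.
move=> h_inj hE h_onto.
have ex_f (v : vertex D) : exists w : vertex E, h (val w) == val v.
  have [w hw] := h_onto _ (valP v).
  have wE : [set w] \in E by rewrite hE imset_set1 hw (valP v).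
  by exists (Sub w wE); rewrite SubK hw.
pose f v := xchoose (ex_f v).
have hf v : h (val (f v)) = val v by apply/eqP/(xchooseP (ex_f v)).
have g_vertex (w : vertex E) : [set h (val w)] \in D.
  by rewrite -imset_set1 -hE (valP w).
exists f; split.
  exists (fun w => exist _ (h (val w)) (g_vertex w)) => [v|w].
    by apply: val_inj; rewrite /= hf.
  by apply/val_inj/h_inj; rewrite hf.
move=> F; rewrite hE -imset_comp; apply: (congr1 (fun G => G \in D)).
by apply: eq_imset => v; rewrite /= hf.
Qed.

Section Squeezing.
Local Open Scope nat_scope.

Variables (n d o m : nat) (D : {set {set 'I_n}}).

Hypothesis n_eq : n = o + (m + d).
Hypothesis D_down : forall F G : {set 'I_n}, F \in D -> G \subset F -> G \in D.
Hypothesis D_shifted : shifted_complex D.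
Hypothesis D_extend :
  forall F, F \in D -> exists G, [/\ G \in D, #|G| = d & F \subset G].
Hypothesis D_nonempty : set0 \in D.
Hypothesis vertex_ge : forall v, [set v] \in D -> o <= v.
Hypothesis first_vertex :
  0 < m -> exists2 v : 'I_n, val v = o & [set v] \in D.

Definition monomial_face (u : 'X_{1..m}) : {set 'I_n} :=
  values n d (fun l => o + (var_at u l + l)).

(** Bounding the degree by d makes the set finite; [monomial_face] would
    truncate a monomial of larger degree. *)
Definition facet_ideal : {fset 'X_{1..m}} :=
  [fset val b | b in
    [pred b : 'X_{1..m < d.+1} | monomial_face (val b) \in D]]%fset.

Lemma facet_idealP u :
  reflect (mdeg u <= d /\ monomial_face u \in D) (u \in facet_ideal).
Proof.
apply: (iffP (imfsetP _ _ _ _)) => /= [[b bD ->]|[ud uD]].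
  by split => //; rewrite -ltnS; case: (b).
by rewrite -ltnS in ud; exists (BMultinom ud).
Qed.

Lemma var_at_increasing (u : 'X_{1..m}) :
  increasing_below d (fun l => o + (var_at u l + l)).
Proof. by move=> i j ij _; have := var_at_homo u (ltnW ij); lia. Qed.

Lemma var_at_bound (u : 'X_{1..m}) l : l < d -> o + (var_at u l + l) < n.
Proof. by move=> ld; have := var_at_le u l; rewrite n_eq; lia. Qed.

Lemma monomial_face_raise a v :
  increasing_below d a -> values n d a \in D ->
  (forall l, l < d -> a l <= o + (var_at v l + l)) -> monomial_face v \in D.
Proof.
move=> inc_a aD le_av; apply: shifted_values_raise aD => //.
  exact: var_at_increasing.
exact: var_at_bound.
Qed.

(** Both closure properties of the ideal are instances of this one: passing to
    a divisor and replacing a variable by a later one can only lower the degree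
    in the variables of index at most j. *)
Lemma facet_ideal_below u v :
  mdeg v <= mdeg u ->
  (forall j, j < m -> \sum_(i < m | i <= j) v i <= \sum_(i < m | i <= j) u i) ->
  u \in facet_ideal -> v \in facet_ideal.
Proof.
move=> vu sum_vu /facet_idealP[ud uD]; apply/facet_idealP; split.
  exact: leq_trans ud.
apply: monomial_face_raise uD _; first exact: var_at_increasing.
by move=> l _; rewrite leq_add2l leq_add2r var_at_anti.
Qed.

Lemma face_sequence F : F \in D -> #|F| = d ->
  exists a, [/\ increasing_below d a, F = values n d a &
    forall l, l < d -> o + l <= a l <= o + (m + l)].
Proof.
move=> FD Fd; have [a []] := increasing_face_bounds D_down vertex_ge FD.
rewrite Fd => inc_a Fa a_bd; exists a; split=> // l ld.
by have := a_bd l ld; rewrite n_eq; lia.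
Qed.

Lemma facet_is_monomial_face F : F \in D -> #|F| = d ->
  exists2 u, u \in facet_ideal & F = monomial_face u.
Proof.
move=> FD Fd; have [a [inc_a Fa a_bd]] := face_sequence FD Fd.
pose t := mkseq (fun l => a l - (o + l)) d.
have srt : sorted leq t.
  apply/(sortedP 0) => l; rewrite size_mkseq => ld.
  rewrite !nth_mkseq //; last exact: ltnW.
  by have := inc_a l l.+1 (ltnSn l) ld; lia.
have tm : all (leq^~ m) t.
  apply/(all_nthP 0) => l; rewrite size_mkseq => ld; rewrite nth_mkseq //.
  by have := a_bd l ld; lia.
have [u ud ut] := monomial_of_sorted srt tm.
have Fu : F = monomial_face u.
  rewrite Fa; apply: eq_values => l ld; rewrite ut nth_mkseq //.
  by have := a_bd l ld; lia.
exists u => //; apply/facet_idealP; rewrite -Fu; split=> //.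
by rewrite size_mkseq in ud.
Qed.

Lemma facet_ideal_order : order_ideal facet_ideal.
Proof.
have [G [GD Gd _]] := D_extend D_nonempty.
split=> [|i|u v uU /mnm_lepP vu].
- have [u uU _] := facet_is_monomial_face GD Gd.
  apply: facet_ideal_below uU; first by rewrite mdeg0.
  by move=> j _; rewrite big1 // => i _; rewrite mnm0E.
- (* The face of x_i starts with o + i and then takes the highest possible
     values, so a facet through the vertex o lies below it. *)
  have m0 : 0 < m by apply: leq_ltn_trans (ltn_ord i).
  have [v vo vD] := first_vertex m0.
  have [F [FD Fd vF]] := D_extend vD.
  have [a [inc_a Fa a_bd]] := face_sequence FD Fd.
  have vFa : v \in values n d a by rewrite -Fa -sub1set.
  have d0 : 0 < d by case/valuesP: vFa => l; lia.
  have a0 : a 0 = o.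
    case/valuesP: vFa => l ld; rewrite vo => al.
    by have := a_bd _ d0; have := increasing_gap inc_a (leq0n l) ld; lia.
  apply/facet_idealP; rewrite mdeg1; split=> //.
  apply: (monomial_face_raise inc_a); first by rewrite -Fa.
  case=> [|l] ld; first by rewrite a0; lia.
  by rewrite var_at_default ?mdeg1 //; have /andP[_] := a_bd _ ld.
apply: facet_ideal_below uU; first by rewrite !mdegE leq_sum.
by move=> j _; apply: leq_sum.
Qed.

Lemma facet_ideal_shifted : shifted_ideal facet_ideal.
Proof.
move=> u i j ij; apply: facet_ideal_below; first by rewrite !mdegD !mdeg1.
move=> c _; under eq_bigr do rewrite mnmDE.
under [leqRHS]eq_bigr do rewrite mnmDE.
rewrite !big_split leq_add2r /=.
have sumU (x : 'I_m) : \sum_(y < m | y <= c) U_(x)%MM y = (x <= c).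
  under eq_bigr do rewrite mnm1E.
  case: leqP => xc; last first.
    rewrite big1 // => y yc; apply/eqP; rewrite eqb0; apply/eqP => xy.
    by move: xc; rewrite xy; lia.
  rewrite (bigD1 x) //= eqxx big1 // => y /andP[_ /negbTE].
  by rewrite eq_sym => ->.
by rewrite !sumU; case: (leqP j c) => // jc; rewrite (leq_trans (ltnW ij)).
Qed.

Lemma dmax_facet_ideal : dmax facet_ideal <= d.
Proof. by apply/bigmax_leqP_seq => u /facet_idealP[]. Qed.

Lemma mdeg_le_dmax u : u \in facet_ideal -> mdeg u <= dmax facet_ideal.
Proof. by move=> uU; apply: (leq_bigmax_seq _ (P := xpredT)). Qed.

(** Past the degree of u the terms m + l, l = mdeg u, mdeg u + 1, ..., run
    through the final segment in the definition of [F0]. *)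
Lemma mem_F0 u (c : 'I_(m + dmax facet_ideal)) : u \in facet_ideal ->
  (c \in F0 facet_ideal u) =
  [exists l : 'I_d, nat_of_ord c == var_at u l + l].
Proof.
move=> uU; have ud := mdeg_le_dmax uU; have Ud := dmax_facet_ideal.
have cm := ltn_ord c; rewrite inE.
have nthE l : l < mdeg u ->
    nth 0 [seq nat_of_ord i | i <- m2s u] l = var_at u l.
  by move=> lu; apply: set_nth_default; rewrite size_map size_m2s.
apply/orP/existsP => [[/existsP[l /eqP ->]|uc]|[l /eqP ->]].
- have ld : l < d by have := ltn_ord l; lia.
  by exists (Ordinal ld); rewrite nthE.
- have ld : c - m < d by lia.
  by exists (Ordinal ld); rewrite /= var_at_default; lia.
have [lu|ul] := ltnP l (mdeg u); last by right; rewrite var_at_default; lia.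
by left; apply/existsP; exists (Ordinal lu); rewrite nthE.
Qed.

(** The ground set of the join is placed in 'I_n by shifting 'I_(m + dmax U)
    by o and letting the vertices of the simplex follow.  A face of the join
    then lies in the face of a monomial; conversely a face of D extends to some
    d-element face, which comes from a monomial of U. *)
Lemma squeezing_iso :
  complex_iso D (join (Delta0 facet_ideal) (simplex (d - dmax facet_ideal))).
Proof.
set U := facet_ideal; set k := d - _; have Ud : dmax U <= d := dmax_facet_ideal.
pose pos (w : 'I_(m + dmax U) + 'I_k) :=
  match w with inl c => o + c | inr c => o + (m + (dmax U + c)) end.
have pos_lt w : pos w < n.
  by rewrite n_eq /pos /k; case: w => c; have := ltn_ord c; rewrite /k; lia.
pose h w := Ordinal (pos_lt w).
have h_inj : injective h.
  move=> w w' /(congr1 val) /=.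
  case: w w' => c [] c' /= eq_c; have := ltn_ord c; have := ltn_ord c'.
  - by move=> _ _; congr inl; apply: val_inj => /=; lia.
  - by lia.
  - by lia.
  by move=> _ _; congr inr; apply: val_inj => /=; lia.
apply: (complex_iso_of_injection h_inj) => [A|v vD].
  apply/imset2P/idP => [[F G]|AD].
    rewrite inE => /existsP[[u uU] /= Fu] _ ->.
    have /facet_idealP[_ uD] := uU; apply: D_down uD _.
    have := mdeg_le_dmax uU; rewrite -/U => uU'.
    apply/subsetP => _ /imsetP[w ww ->]; apply/valuesP => /=.
    move: ww; rewrite inE => /orP[] /imsetP[c cF ->] /=.
      move/(subsetP Fu): cF; rewrite mem_F0 // => /existsP[l /eqP ->].
      by exists l.
    have := ltn_ord c; rewrite {2}/k => ck.
    by exists (dmax U + c); rewrite ?var_at_default; lia.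
  have [G [GD Gd AG]] := D_extend AD.
  have [u uU Gu] := facet_is_monomial_face GD Gd.
  exists (inl @^-1: A) (inr @^-1: A); rewrite ?inE //.
    apply/existsP; exists [` uU]%fset; apply/subsetP => c; rewrite inE => cA /=.
    have : h (inl c) \in monomial_face u.
      by rewrite -Gu (subsetP AG) // imset_f.
    case/valuesP => l ld /= /addnI cl.
    by rewrite mem_F0 //; apply/existsP; exists (Ordinal ld); rewrite cl.
  apply/setP => w; apply/idP/setUP => [wA|].
    by case: w wA => c cA; [left|right]; rewrite imset_f ?inE.
  by case=> /imsetP[c]; rewrite inE => cA ->.
have ov := vertex_ge vD; have vn := ltn_ord v.
have [vl|vr] := ltnP (v - o) (m + dmax U).
  by exists (inl (Ordinal vl)); apply: val_inj => /=; lia.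
have vk : v - o - (m + dmax U) < k by rewrite /k; lia.
by exists (inr (Ordinal vk)); apply: val_inj => /=; lia.
Qed.

End Squeezing.

Lemma complex_dim_simplex k : complex_dim (simplex k) = (k%:Z - 1)%R.
Proof.
rewrite /complex_dim; congr (Posz _ - 1)%R; apply/eqP.
rewrite eqn_leq; apply/andP; split.
  by apply/bigmax_leqP => F _; rewrite -[leqRHS]card_ord max_card.
rewrite -[leqLHS]card_ord -cardsT.
by apply: (leq_bigmax_cond [set: 'I_k]); rewrite inE.
Qed.

Local Open Scope ring_scope.

Theorem corollary3p16 (n d : nat) (D : {set {set 'I_n}}) :
  simplicial_complex D ->
  complex_dim D = d%:Z - 1 ->
  pure D ->
  shifted_complex D ->
  exists (m : nat) (U : {fset 'X_{1..m}}) (k : nat),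
    [/\ order_ideal U,
        shifted_ideal U,
        complex_dim (simplex k) = d%:Z - 1 - (dmax U)%:Z &
        complex_iso D (join (Delta0 U) (simplex k))].
Proof.
move=> [D0 Ddown] dimD pureD shD.
have dE : d = (\max_(F in D) #|F|)%N by move: dimD; rewrite /complex_dim; lia.
have card_le F : F \in D -> (#|F| <= d)%N.
  by move=> FD; rewrite dE; apply: leq_bigmax_cond.
have D_gt0 : (0 < #|D|)%N by apply/card_gt0P; exists set0.
have [M MD Md] := eq_bigmax_cond (fun F : {set 'I_n} => #|F|) D_gt0.
rewrite -dE in Md.
have Mfacet : facet D M.
  apply/maxsetP; split=> // B BD MB; apply/eqP.
  by rewrite eq_sym eqEcard MB -Md card_le.
have Dext F : F \in D -> exists G, [/\ G \in D, #|G| = d & F \subset G].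
  move=> FD; have [G Gf FG] := maxset_exists (P := mem D) FD.
  have [GD _] := maxsetP Gf; exists G; split=> //.
  by have := pureD _ _ Gf Mfacet; rewrite /face_dim -Md; lia.
have [o [on vge vfirst]] : exists o, [/\ (o <= n)%N,
    forall v : 'I_n, [set v] \in D -> (o <= v)%N &
    (o < n)%N -> exists2 v : 'I_n, val v = o & [set v] \in D].
  have [/existsP[v0 v0D]|none] := boolP [exists v : 'I_n, [set v] \in D].
    have [v vD vmin] :=
      arg_minnP (@nat_of_ord n) (P := fun v => [set v] \in D) v0D.
    by exists v; split=> [|//|_]; [apply: ltnW | exists v].
  exists n; split=> [//|v vD|]; last by rewrite ltnn.
  by case/existsP: none; exists v.
have Mon : (d <= n - o)%N.
  have [a [_ _]] := increasing_face_bounds Ddown vge MD; rewrite -Md => a_bd.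
  have dn : (d <= n)%N by rewrite Md -[leqRHS]card_ord max_card.
  by have [->//|d0] := posnP d; have := a_bd _ d0; lia.
have nE : n = (o + (n - o - d + d))%N by lia.
have first : (0 < n - o - d)%N -> exists2 v : 'I_n, val v = o & [set v] \in D.
  by move=> pos; apply: vfirst; lia.
pose U := facet_ideal d o (n - o - d) D.
exists (n - o - d)%N, U, (d - dmax U)%N; split.
- exact: facet_ideal_order.
- exact: facet_ideal_shifted.
- have Ud : (dmax U <= d)%N by exact: dmax_facet_ideal.
  by rewrite complex_dim_simplex -subzn // GRing.addrAC.
exact: squeezing_iso.
Qed.
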